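(* Let $\boldsymbol{u}\in\{0,1\}^{\mathbb N}$. (i) $\phi(1\boldsymbol{u})=1^\infty$. (ii) If $\boldsymbol{u}\in\{0^\infty,1^\infty\}$, then $\phi(0\boldsymbol{u})=\boldsymbol{u}$. (iii) If $\boldsymbol{u}$ is a characteristic Sturmian sequence, then $\phi(0\boldsymbol{u})=1\boldsymbol{u}$. Furthermore, $1\boldsymbol{u}$ is the unique Sturmian sequence in $\{0,1\}^{\mathbb N}$ satisfying $0\boldsymbol{u}\le T^k(1\boldsymbol{u})\le 1\boldsymbol{u}$ for all $k\ge0$. (iv) If $\boldsymbol{u}$ is a characteristic periodic balanced sequence of rational slope $p/q\in(0,1)$ with $\gcd(p,q)=1$, then $\phi(0\boldsymbol{u})=\boldsymbol{s}'_{p/q,0}=(1w_{p,q}0)^\infty$. (v) If $\boldsymbol{u}$ is not of any of the forms in (ii)–(iv), then there exists a unique pair of coprime integers $p,q$ with $0<p<q$ such that $(w_{p,q}01)^\infty<\boldsymbol{u}<(w_{p,q}10)^\infty$, and then $\phi(0\boldsymbol{u})=\boldsymbol{s}'_{p/q,0}=(1w_{p,q}0)^\infty$. Moreover, in cases (iv) and (v), $\phi(0\boldsymbol{u})$ is the unique periodic balanced sequence in $\{0,1\}^{\mathbb N}$ satisfying $0\boldsymbol{u}\le T^k(\phi(0\boldsymbol{u}))\le\phi(0\boldsymbol{u})$ for all $k\ge0$.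
   Context: $\le$ denotes the lexicographic order on $\{0,1\}^{\mathbb N}$ induced by $0<1$; $T$ is the shift map $T((s_n)_{n\ge0})=(s_{n+1})_{n\ge0}$; $v^\infty=vvv\cdots$. For $\boldsymbol{x},\boldsymbol{y}\in\{0,1\}^{\mathbb N}$ let $\Sigma_{\boldsymbol{x},\boldsymbol{y}}=\{\boldsymbol{s}\in\{0,1\}^{\mathbb N}: \boldsymbol{x}\le T^k(\boldsymbol{s})\le\boldsymbol{y}\ \forall k\ge0\}$ and $\phi(\boldsymbol{x}):=\inf\{\boldsymbol{y}\in\{0,1\}^{\mathbb N}:\Sigma_{\boldsymbol{x},\boldsymbol{y}}\neq\emptyset\}$. For real $\alpha,\rho\in[0,1]$ define $\boldsymbol{s}_{\alpha,\rho}(n)=\lfloor(n+1)\alpha+\rho\rfloor-\lfloor n\alpha+\rho\rfloor$ and $\boldsymbol{s}'_{\alpha,\rho}(n)=\lceil(n+1)\alpha+\rho\rceil-\lceil n\alpha+\rho\rceil$ ($n\ge0$); these are Sturmian sequences of slope $\alpha$ if $\alpha$ is irrational and periodic balanced sequences if $\alpha$ is rational, and characteristic when $\alpha=\rho$. A characteristic Sturmian sequence is $\boldsymbol{s}_{\alpha,\alpha}=\boldsymbol{s}'_{\alpha,\alpha}$ with $\alpha\in(0,1)$ irrational. For coprime $0<p<q$, $w_{p,q}$ is the unique word of length $q-2$ with $\boldsymbol{s}_{p/q,0}=(0w_{p,q}1)^\infty$ and $\boldsymbol{s}'_{p/q,0}=(1w_{p,q}0)^\infty$ (the central word of slope $p/q$);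 the characteristic periodic balanced sequences of slope $p/q$ are $(w_{p,q}10)^\infty$ and $(w_{p,q}01)^\infty$.
   Formalization: Both uniqueness claims fail as worded (1^∞, larger slopes or shifts of f=φ(0u) also qualify); proved instead: a Sturmian/periodic balanced s with 0u≤T^k(s)≤f for all k has the slope of u (iii) or is a shift of f (iv, v), and s=f if also T^k(s)≤s for all k. *)

(* Defs.v *)
From HB Require Import structures.
From mathcomp Require Import all_boot all_order all_algebra.
From mathcomp Require Import boolp classical_sets reals.
From mathcomp Require Import zify ring lra.

Set Implicit Arguments.
Unset Strict Implicit.
Unset Printing Implicit Defensive.

Import Order.TTheory GRing.Theory Num.Theory.
Local Open Scope classical_set_scope.
Local Open Scope ring_scope.

(* {0,1}^N, with false = 0 and true = 1 *)
Definition binseq := nat -> bool.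

HB.instance Definition _ := gen_eqMixin binseq.
HB.instance Definition _ := gen_choiceMixin binseq.

Section Lexicographic.
Implicit Types x y z : binseq.

Definition lex_ltP x y : Prop :=
  exists n, (forall i, (i < n)%N -> x i = y i) /\ (x n < y n)%O.

Definition lex_lt : rel binseq := fun x y => `[< lex_ltP x y >].
Definition lex_le : rel binseq := fun x y => (x == y) || lex_lt x y.

Lemma lex_lt_def x y : lex_lt x y = (y != x) && lex_le x y.
Proof.
rewrite /lex_le (eq_sym x); case: eqVneq => //= ->.
by apply/asboolP => -[n [_]]; rewrite ltxx.
Qed.

Lemma lex_lt_trans : transitive lex_lt.
Proof.
move=> y x z /asboolP[n [xy hn]] /asboolP[m [yz hm]]; apply/asboolP.
have [nm|mn|e] := ltngtP n m.
- exists n; split=> [i lin|]; last by rewrite -yz.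
  by rewrite xy // yz // (ltn_trans lin).
- exists m; split=> [i lim|]; last by rewrite xy.
  by rewrite xy ?yz // (ltn_trans lim).
- subst m; exists n; split=> [i lin|]; first by rewrite xy ?yz.
  exact: lt_trans hn hm.
Qed.

Lemma lex_le_refl : reflexive lex_le.
Proof. by move=> x; rewrite /lex_le eqxx. Qed.

Lemma lex_le_anti : antisymmetric lex_le.
Proof.
move=> x y /andP[]; rewrite /lex_le; case: eqVneq => //= _ xy yx.
have := lex_lt_trans xy yx.
by rewrite lex_lt_def eqxx.
Qed.

Lemma lex_le_trans : transitive lex_le.
Proof.
move=> y x z /orP[/eqP->//|xy] /orP[/eqP<-|yz].
  by rewrite /lex_le xy orbT.
by rewrite /lex_le (lex_lt_trans xy yz) orbT.
Qed.

Lemma lex_le_total : total lex_le.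
Proof.
move=> x y; rewrite /lex_le; case: (eqVneq x y) => //= nxy.
have ex : exists n, x n != y n.
  apply/not_existsP => h; move/eqP: nxy; apply; apply/funext => n.
  by apply/eqP; move/negP: (h n); rewrite negbK.
have [n nn hmin] := ex_minnP ex.
have he i : (i < n)%N -> x i = y i.
  by move=> lin; apply/eqP; apply: contraTT lin => /hmin; rewrite -leqNgt.
have [h|h] : (x n < y n)%O \/ (y n < x n)%O.
  by case: (x n) (y n) nn => -[] //= _; [right|left].
- by apply/orP; left; apply/asboolP; exists n.
- apply/orP; right; apply/asboolP; exists n.
  by split=> // i /he.
Qed.

End Lexicographic.

Fact lex_display : Order.disp_t. Proof. exact: (Order.Disp tt tt). Qed.

HB.instance Definition _ := Order.isPOrder.Build lex_display binseq
  lex_lt_def lex_le_refl lex_le_anti lex_le_trans.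
HB.instance Definition _ :=
  Order.POrder_isTotal.Build lex_display binseq lex_le_total.

Definition shift (s : binseq) : binseq := fun n => s n.+1.

Definition bcons (b : bool) (s : binseq) : binseq :=
  fun n => if n is m.+1 then s m else b.

Definition bconst (b : bool) : binseq := fun=> b.

(* v^oo, for a nonempty word v *)
Definition per (v : seq bool) : binseq := fun n => nth false v (n %% size v)%N.

Definition Sigma (x y : binseq) : set binseq :=
  [set s | forall k, (x <= iter k shift s)%O /\ (iter k shift s <= y)%O].

(* The default value of [infimum] is irrelevant, see [phiP]. *)
Definition phi (x : binseq) : binseq :=
  infimum (bconst true) [set y | Sigma x y !=set0].

Lemma lex_ltE (x y : binseq) : (x < y)%O <-> lex_ltP x y.
Proof. by split=> /asboolP. Qed.

Lemma lex_top (x : binseq) : (x <= bconst true)%O.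
Proof.
rewrite leNgt; apply/negP => /lex_ltE[n [_]].
by rewrite /bconst; case: (x n).
Qed.

Lemma iter_shiftE k (s : binseq) n : iter k shift s n = s (k + n)%N.
Proof. by elim: k n => //= k IH n; rewrite /shift IH addnS. Qed.

Section Infimum.
Variable A : set binseq.

(* prefix of length n of the infimum of A *)
Fixpoint inf_prefix n : seq bool :=
  if n is m.+1 then
    let p := inf_prefix m in
    rcons p (~~ `[< exists2 x, A x & mkseq x m.+1 = rcons p false >])
  else [::].

Let z : binseq := fun n => nth false (inf_prefix n.+1) n.

Let size_ip n : size (inf_prefix n) = n.
Proof. by elim: n => //= n IH; rewrite size_rcons IH. Qed.

Let ipE n : inf_prefix n = mkseq z n.
Proof.
elim: n => // n IH; rewrite mkseqS -IH /z /=.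
by rewrite nth_rcons size_ip ltnn eqxx.
Qed.

Let zE n : z n = ~~ `[< exists2 x, A x & mkseq x n.+1 = rcons (mkseq z n) false >].
Proof. by rewrite {1}/z /= nth_rcons size_ip ltnn eqxx ipE. Qed.

Let mkseq_ext (x y : binseq) n :
  mkseq x n = mkseq y n <-> forall i, (i < n)%N -> x i = y i.
Proof.
split=> [h i lin|h].
  by rewrite -(nth_mkseq false x lin) h nth_mkseq.
by apply/eq_in_map => i; rewrite mem_iota => /andP[_ lin]; apply: h.
Qed.

Lemma infimums_lex : A !=set0 -> infimums A z.
Proof.
move=> A0; split=> [x Ax|y lby].
  rewrite leNgt; apply/negP => /lex_ltE[n [xz]].
  rewrite zE; case: asboolP => /=; first by case: (x n).
  move=> nex; case e: (x n) => // _; apply: nex; exists x => //.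
  by rewrite mkseqS e; congr rcons; apply/mkseq_ext.
have hpre n : exists2 x, A x & mkseq x n = mkseq z n.
  elim: n => [|n [x Ax e]]; first by case: A0 => x Ax; exists x.
  rewrite mkseqS zE; case: asboolP => //= nex; exists x => //.
  rewrite mkseqS e; congr rcons; apply/negPn/negP => /negbTE xn.
  by apply: nex; exists x; rewrite // mkseqS e xn.
rewrite leNgt; apply/negP => /lex_ltE[n [zy hn]].
have [x Ax /mkseq_ext e] := hpre n.+1.
have := lby _ Ax; rewrite leNgt => /negP; apply; apply/lex_ltE.
exists n; split=> [i lin|]; last by rewrite e.
by rewrite e ?zy // ltnS ltnW.
Qed.

End Infimum.

Lemma phiP x : infimums [set y | Sigma x y !=set0] (phi x).
Proof.
have ne : [set y | Sigma x y !=set0] !=set0.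
  exists (bconst true), (bconst true) => k; split; last exact: lex_top.
  suff -> : iter k shift (bconst true) = bconst true by exact: lex_top.
  by apply/funext => n; rewrite iter_shiftE.
rewrite /phi /infimum; case: ifPn => [/eqP e|_].
  by move: ne; rewrite e => -[].
by case: xgetP => [y _ //|/(_ _ (infimums_lex ne))].
Qed.

Section Mechanical.
Variable R : realType.
Implicit Types (a rho : R) (s u : binseq) (p q n : nat).

(* s_{a,rho} and s'_{a,rho}: for 0 <= a <= 1 the differences below lie in
   {0,1}, see [sturmE] and [sturm'E]. *)
Definition sturm a rho : binseq := fun n =>
  Num.floor (n.+1%:R * a + rho) - Num.floor (n%:R * a + rho) == 1.

Definition sturm' a rho : binseq := fun n =>
  Num.ceil (n.+1%:R * a + rho) - Num.ceil (n%:R * a + rho) == 1.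

Lemma sturmE a rho n : 0 <= a <= 1 ->
  Num.floor (n.+1%:R * a + rho) - Num.floor (n%:R * a + rho)
  = (sturm a rho n : nat)%:Z.
Proof.
move=> /andP[a0 a1]; rewrite /sturm.
set f := Num.floor (n.+1%:R * a + rho); set g := Num.floor (n%:R * a + rho).
have /andP[] := floor_itv (n.+1%:R * a + rho); rewrite -/f.
have /andP[] := floor_itv (n%:R * a + rho); rewrite -/g.
rewrite !intrD -natr1 => h1 h2 h3 h4.
have : (g%:~R < (f + 1)%:~R :> R) by rewrite intrD; lra.
have : (f%:~R < (g + 2)%:~R :> R) by rewrite intrD; lra.
rewrite !ltr_int => l1 l2.
have : f - g = 0 \/ f - g = 1 by lia.
by case=> ->.
Qed.

Lemma sturm'E a rho n : 0 <= a <= 1 ->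
  Num.ceil (n.+1%:R * a + rho) - Num.ceil (n%:R * a + rho)
  = (sturm' a rho n : nat)%:Z.
Proof.
move=> /andP[a0 a1]; rewrite /sturm'.
set f := Num.ceil (n.+1%:R * a + rho); set g := Num.ceil (n%:R * a + rho).
have /andP[] := ceil_itv (n.+1%:R * a + rho); rewrite -/f.
have /andP[] := ceil_itv (n%:R * a + rho); rewrite -/g.
rewrite !intrD -natr1 => h1 h2 h3 h4.
have : (g%:~R < (f + 1)%:~R :> R) by rewrite intrD; lra.
have : (f%:~R < (g + 2)%:~R :> R) by rewrite intrD; lra.
rewrite !ltr_int => l1 l2.
have : f - g = 0 \/ f - g = 1 by lia.
by case=> ->.
Qed.

Definition has_slope a s : Prop :=
  0 <= a <= 1 /\
  exists2 rho, 0 <= rho <= 1 & s = sturm a rho \/ s = sturm' a rho.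

Definition sturmian s : Prop := exists2 a, irrational a & has_slope a s.

Definition periodic_balanced s : Prop := exists2 a, rational a & has_slope a s.

Definition char_sturmian s : Prop :=
  exists2 a, 0 < a < 1 /\ irrational a & s = sturm a a.

Definition slope_pair p q : Prop := [/\ (0 < p)%N, (p < q)%N & coprime p q].

(* The central word w_{p,q}: s_{p/q,0} stripped of its first letter, cut at
   length q - 2; [centralP] gives its characterization. *)
Definition central p q : seq bool :=
  mkseq (fun i => sturm (p%:R / q%:R) 0 i.+1) (q - 2).

Definition char_periodic p q s : Prop :=
  slope_pair p q /\
  (s = per (central p q ++ [:: true; false]) \/
   s = per (central p q ++ [:: false; true])).

Definition generic u : Prop :=
  [/\ u <> bconst false, u <> bconst true, ~ char_sturmian u &
      ~ exists p q, char_periodic p q u].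

Definition in_gap p q u : Prop :=
  slope_pair p q /\
  (per (central p q ++ [:: false; true]) < u)%O /\
  (u < per (central p q ++ [:: true; false]))%O.

Section CentralWord.
Variables p q : nat.
Hypothesis hpq : slope_pair p q.
Local Notation a := (p%:R / q%:R : R).

Let q0 : (0 < q)%N. Proof. by case: hpq => ? ? _; lia. Qed.
Let q0R : (0 : R) < q%:R. Proof. by rewrite ltr0n. Qed.

Let floorE n : Num.floor (n%:R * a + 0) = (n * p %/ q)%N :> int.
Proof.
apply: floor_def; rewrite addr0 mulrA -natrM.
rewrite ler_pdivlMr // ltr_pdivrMr // intrD -!pmulrn -natrM natr1 -natrM.
by rewrite ler_nat ltr_nat leq_trunc_div /= mulnC ltn_ceil.
Qed.

Let ceilE n : Num.ceil (n%:R * a + 0) = ((n * p + q.-1) %/ q)%N :> int.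
Proof.
have := leq_trunc_div (n * p + q.-1) q.
have := ltn_ceil (n * p + q.-1) q0.
set m := (_ %/ q)%N => h1 h2; apply: ceil_def; rewrite addr0 mulrA -natrM.
rewrite ltr_pdivlMr // ler_pdivrMr // intrD -!pmulrn -natrM ler_nat.
rewrite mulrDl mulN1r -natrM ltrBlDr -natrD ltr_nat.
by apply/andP; split; lia.
Qed.

Let divS m : ((m %/ q).+1 = (m + q) %/ q)%N.
Proof. by rewrite divnDr ?dvdnn // divnn q0 addn1. Qed.

Let sturmN n : sturm a 0 n = (n.+1 * p %/ q != n * p %/ q)%N.
Proof.
have /andP[] : (n * p %/ q <= n.+1 * p %/ q)%N && (n.+1 * p %/ q <= (n * p %/ q).+1)%N.
  have [_ pq _] := hpq.
  by rewrite divS !leq_div2r //; lia.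
by rewrite /sturm !floorE; lia.
Qed.

Let sturm'N n :
  sturm' a 0 n = ((n.+1 * p + q.-1) %/ q != (n * p + q.-1) %/ q)%N.
Proof.
have /andP[] : ((n * p + q.-1) %/ q <= (n.+1 * p + q.-1) %/ q)%N &&
   ((n.+1 * p + q.-1) %/ q <= ((n * p + q.-1) %/ q).+1)%N.
  have [_ pq _] := hpq.
  by rewrite divS !leq_div2r //; lia.
by rewrite /sturm' !ceilE; lia.
Qed.

Let sturm_mod n : sturm a 0 n = sturm a 0 (n %% q)%N.
Proof.
rewrite !sturmN {1 2}(divn_eq n q) -addnS !mulnDl.
by rewrite mulnAC !divnMDl // eqn_add2l.
Qed.

Let sturm'_mod n : sturm' a 0 n = sturm' a 0 (n %% q)%N.
Proof.
rewrite !sturm'N {1 2}(divn_eq n q) -addnS !mulnDl -!addnA.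
by rewrite mulnAC !divnMDl // eqn_add2l.
Qed.

Let ceil_floor n : (0 < n < q)%N ->
  ((n * p + q.-1) %/ q = (n * p %/ q).+1)%N.
Proof.
move=> /andP[n0 nq]; have [_ _ cpq] := hpq.
have nd : ~~ (q %| n * p)%N.
  rewrite Gauss_dvdl 1?coprime_sym //; apply/negP => /dvdn_leq; lia.
rewrite {1}(divn_eq (n * p) q) -addnA divnMDl // -addn1; congr addn.
have := ltn_pmod (n * p) q0; move: nd; rewrite /dvdn => nd lm.
have -> : ((n * p) %% q + q.-1 = 1 * q + ((n * p) %% q).-1)%N by lia.
by rewrite divnMDl // divn_small //; lia.
Qed.

Lemma size_central : size (central p q) = (q - 2)%N.
Proof. by rewrite size_mkseq. Qed.

Let q2 : (2 <= q)%N. Proof. by case: hpq => ? ? _; lia. Qed.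

Lemma central_lower : sturm a 0 = per (false :: central p q ++ [:: true]).
Proof.
have [p0 pq cpq] := hpq.
apply/funext => n; rewrite /per /= size_cat size_central /=.
have -> : ((q - 2 + 1).+1 = q)%N by lia.
rewrite sturm_mod; have := ltn_pmod n q0; move: (n %% q)%N => [|m] lm /=.
  by rewrite sturmN mul0n mul1n div0n divn_small.
rewrite nth_cat size_central; case: ltnP => h; first by rewrite nth_mkseq.
have -> : (m - (q - 2) = 0)%N by lia.
have -> : m.+1 = q.-1 by lia.
rewrite sturmN prednK // mulKn // /=.
suff: (q.-1 * p %/ q < p)%N by move=> h'; rewrite gtn_eqF.
by rewrite ltn_divLR // mulnC ltn_mul2l p0 prednK //=.
Qed.

Lemma central_upper : sturm' a 0 = per (true :: central p q ++ [:: false]).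
Proof.
have [p0 pq cpq] := hpq.
apply/funext => n; rewrite /per /= size_cat size_central /=.
have -> : ((q - 2 + 1).+1 = q)%N by lia.
rewrite sturm'_mod; have := ltn_pmod n q0; move: (n %% q)%N => [|m] lm /=.
  rewrite sturm'N mul0n add0n [(q.-1 %/ q)%N]divn_small ?prednK //.
  by rewrite ceil_floor ?ltn0Sn //; lia.
rewrite nth_cat size_central; case: ltnP => h.
  by rewrite nth_mkseq // sturm'N sturmN !ceil_floor ?eqSS //; lia.
have -> : (m - (q - 2) = 0)%N by lia.
rewrite /= sturm'N; apply/negbTE; rewrite negbK (@ceil_floor m.+1); last lia.
have -> : m.+1 = q.-1 by lia.
rewrite prednK // [(q * p)%N]mulnC divnMDl // [(q.-1 %/ q)%N]divn_small ?prednK //.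
have -> : (q.-1 * p = p.-1 * q + (q - p))%N.
  by move: p0 pq; clear; case: p q => [|p'] [|q'] //= _; nia.
by rewrite divnMDl // [((q - p) %/ q)%N]divn_small; lia.
Qed.

Lemma centralP w : size w = (q - 2)%N /\
    sturm a 0 = per (false :: w ++ [:: true]) /\
    sturm' a 0 = per (true :: w ++ [:: false])
  <-> w = central p q.
Proof.
split=> [[sw [lw _]]|->]; last first.
  by rewrite size_central -central_lower -central_upper.
apply: (@eq_from_nth _ false); first by rewrite size_central.
move=> i; rewrite sw => hi; rewrite nth_mkseq // lw /per /= size_cat sw /=.
by rewrite modn_small ?nth_cat /= ?nth_cat ?sw ?hi //; lia.
Qed.

Let sturm_shift n : sturm a a n = sturm a 0 n.+1.
Proof. by rewrite /sturm !addr0 -!natr1 !mulrDl !mul1r. Qed.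

Let sturm'_shift n : sturm' a a n = sturm' a 0 n.+1.
Proof. by rewrite /sturm' !addr0 -!natr1 !mulrDl !mul1r. Qed.

Let per_shift b w n : per (b :: w) n.+1 = per (rcons w b) n.
Proof.
rewrite /per size_rcons /=.
have := ltn_pmod n (ltn0Sn (size w)).
rewrite -[in nth _ _ _](addn1 n) -modnDml leq_eqVlt => /orP[/eqP [e]|].
  by rewrite e addn1 modnn nth_rcons ltnn eqxx.
by rewrite ltnS => h; rewrite addn1 modn_small //= nth_rcons h.
Qed.

Lemma char_periodicE s :
  char_periodic p q s <-> s = sturm a a \/ s = sturm' a a.
Proof.
have -> : sturm a a = per (central p q ++ [:: true; false]).
  apply/funext => n; rewrite sturm_shift central_lower per_shift.
  by rewrite -cats1 -catA.
have -> : sturm' a a = per (central p q ++ [:: false; true]).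
  apply/funext => n; rewrite sturm'_shift central_upper per_shift.
  by rewrite -cats1 -catA.
by split=> [[]//|h]; split.
Qed.

End CentralWord.
End Mechanical.

(* Main.v *)
Require Import Defs.
From HB Require Import structures.
From mathcomp Require Import all_boot all_order all_algebra.
From mathcomp Require Import boolp classical_sets reals.
From mathcomp Require Import zify ring lra.

Set Implicit Arguments.
Unset Strict Implicit.
Unset Printing Implicit Defensive.

Import Order.TTheory GRing.Theory Num.Theory.
Local Open Scope ring_scope.

(** For [0 < a < 1] let [u-(a) = sturm' a a] and [u+(a) = sturm a a], so that
    [0 u+(a) = sturm a 0] and [1 u-(a) = sturm' a 0] have prefix sums
    [floor (n a)] and [ceil (n a)].  Every sequence of slope [a] has all its
    shifts between these two, since pointwise comparison of prefix sums implies
    lexicographic comparison.  Conversely, if all shifts of [s] are at least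
    [0 u-(a)], then cutting [s] where it first leaves this bound shows that [s]
    has density of ones at least [a]; if moreover all shifts stayed below some
    [y < 1 u-(a)], the same cutting with blocks of bounded length would give a
    density less than [a].  Hence [phi (0 u) = 1 u-(a)] as soon as
    [u-(a) <= u <= u+(a)], and the same density estimates give uniqueness.
    Finally every nonconstant [u] lies in exactly one interval
    [[u-(a), u+(a)]]: the slope is a supremum, and the ends are reached because
    [ceil] is left-continuous and [floor] right-continuous.  The interval is a
    point for irrational [a] and has the two characteristic periodic balanced
    sequences as ends for rational [a]. *)

(** * Lexicographic order and prepended letters *)

Section LexicographicOrder.
Implicit Types (x y s u : binseq) (b : bool).

Lemma lex_lt_inv x y : (x < y)%O ->
  exists n, [/\ forall i, (i < n)%N -> x i = y i, x n = false & y n = true].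
Proof. by move=> /lex_ltE[n [e xy]]; exists n; move: xy; case: (x n) (y n) => -[]. Qed.

Lemma lex_ltI x y n : (forall i, (i < n)%N -> x i = y i) ->
  x n = false -> y n = true -> (x < y)%O.
Proof. by move=> e xn yn; apply/lex_ltE; exists n; rewrite xn yn. Qed.

Lemma shift_bcons b s : shift (bcons b s) = s.
Proof. by apply/funext. Qed.

Lemma bcons_shift s : bcons (s 0%N) (shift s) = s.
Proof. by apply/funext => -[]. Qed.

Lemma bcons_const b : bcons b (bconst b) = bconst b.
Proof. by apply/funext => -[]. Qed.

Lemma bcons_lt b x y : (bcons b x < bcons b y)%O = (x < y)%O.
Proof.
apply/idP/idP => /lex_lt_inv[n [e xn yn]].
  case: n e xn yn => [|n] e xn yn; first by rewrite /= in xn yn; rewrite xn in yn.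
  by apply: (@lex_ltI _ _ n) => // i lin; apply: (e i.+1).
by apply: (@lex_ltI _ _ n.+1) => // -[//|i] lin; apply: (e i).
Qed.

Lemma bcons_le b x y : (bcons b x <= bcons b y)%O = (x <= y)%O.
Proof. by rewrite !leNgt bcons_lt. Qed.

Lemma lex_bot s : (bconst false <= s)%O.
Proof. by rewrite leNgt; apply/negP => /lex_lt_inv[n []]. Qed.

End LexicographicOrder.

(** * Prefix sums and their link with the lexicographic order *)

Section PrefixSums.
Implicit Types (x y s : binseq).

Definition prefix_sum s n : nat := (\sum_(i < n) s i)%N.

Lemma prefix_sum0 s : prefix_sum s 0 = 0%N.
Proof. by rewrite /prefix_sum big_ord0. Qed.

Lemma prefix_sumS s n : prefix_sum s n.+1 = (prefix_sum s n + s n)%N.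
Proof. by rewrite /prefix_sum big_ord_recr. Qed.

Lemma prefix_sum_bcons b s n :
  prefix_sum (bcons b s) n.+1 = (b + prefix_sum s n)%N.
Proof. by rewrite /prefix_sum big_ord_recl. Qed.

Lemma prefix_sumD s k n :
  prefix_sum s (k + n) = (prefix_sum s k + prefix_sum (iter k shift s) n)%N.
Proof.
elim: n => [|n IH]; first by rewrite addn0 prefix_sum0 addn0.
by rewrite addnS !prefix_sumS IH iter_shiftE addnA.
Qed.

Lemma eq_prefix_sum x y n :
  (forall i, (i < n)%N -> x i = y i) -> prefix_sum x n = prefix_sum y n.
Proof. by move=> e; apply: eq_bigr => i _; rewrite e. Qed.

Lemma prefix_sum_inj x y n :
  (forall i, (i <= n)%N -> prefix_sum x i = prefix_sum y i) ->
  forall i, (i < n)%N -> x i = y i.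
Proof.
move=> e i lin; have := e _ lin; rewrite !prefix_sumS (e i (ltnW lin)).
by move/addnI; case: (x i) (y i) => -[].
Qed.

(** At a first disagreement with [x] above [y], the prefix sum of [x] would overtake that of [y] by
    one. *)
Lemma prefix_sum_le_lex x y :
  (forall n, (prefix_sum x n <= prefix_sum y n)%N) -> (x <= y)%O.
Proof.
move=> h; rewrite leNgt; apply/negP => /lex_lt_inv[n [e yn xn]].
by have := h n.+1; rewrite !prefix_sumS xn yn (eq_prefix_sum e); lia.
Qed.

End PrefixSums.

(** * Mechanical sequences and density estimates *)

Section Mechanical.
Variable R : realType.
Implicit Types (a b c rho : R) (s u y : binseq) (n k : nat).

Lemma natr_le_lt1 (m n : nat) c : (m%:R : R) <= c -> c < n%:R + 1 -> (m <= n)%N.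
Proof. by move=> h1 h2; rewrite -ltnS -(ltr_nat R) -natr1; lra. Qed.

Lemma archimedean_le0 c C : (forall n, n%:R * c <= C) -> c <= 0.
Proof.
move=> h; rewrite leNgt; apply/negP => c0.
have C0 : 0 <= C by have := h 0%N; lra.
have := archi_boundP (divr_ge0 C0 (ltW c0)); set n := Num.bound _.
by rewrite ltr_pdivrMr // ltNge h.
Qed.

Lemma positive_lower_bound N (f : nat -> R) : (forall n, 0 < f n) ->
  exists2 d, 0 < d & forall n, (n <= N)%N -> d <= f n.
Proof.
move=> f0; elim: N => [|N [d d0 h]].
  by exists (f 0%N) => // n; rewrite leqn0 => /eqP ->.
exists (Num.min d (f N.+1)); first by rewrite lt_min d0 f0.
move=> n; rewrite leq_eqVlt ltnS => /orP[/eqP->|/h]; first by rewrite ge_min lexx orbT.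
by apply: le_trans; rewrite ge_min lexx.
Qed.

Lemma prefix_sum_sturm a rho n : 0 <= a <= 1 ->
  (prefix_sum (sturm a rho) n)%:Z
  = Num.floor (n%:R * a + rho) - Num.floor rho.
Proof.
move=> a01; elim: n => [|n IH]; first by rewrite prefix_sum0 mul0r add0r subrr.
by rewrite prefix_sumS PoszD IH -sturmE //; ring.
Qed.

Lemma prefix_sum_sturm' a rho n : 0 <= a <= 1 ->
  (prefix_sum (sturm' a rho) n)%:Z
  = Num.ceil (n%:R * a + rho) - Num.ceil rho.
Proof.
move=> a01; elim: n => [|n IH]; first by rewrite prefix_sum0 mul0r add0r subrr.
by rewrite prefix_sumS PoszD IH -sturm'E //; ring.
Qed.

Lemma prefix_sum_sturm0 a n : 0 <= a <= 1 ->
  n%:R * a - 1 < (prefix_sum (sturm a 0) n)%:R <= n%:R * a.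
Proof.
move=> a01; rewrite [(prefix_sum _ _)%:R]pmulrn prefix_sum_sturm // floor0 subr0 addr0.
have /andP[] := floor_itv (n%:R * a); rewrite intrD => *; lra.
Qed.

Lemma prefix_sum_sturm'0 a n : 0 <= a <= 1 ->
  n%:R * a <= (prefix_sum (sturm' a 0) n)%:R < n%:R * a + 1.
Proof.
move=> a01; rewrite [(prefix_sum _ _)%:R]pmulrn prefix_sum_sturm' // ceil0 subr0 addr0.
have /andP[] := ceil_itv (n%:R * a); rewrite intrD => *; lra.
Qed.

(** A difference of two floors, or of two ceilings, misses the difference of the arguments by less
    than 1, whatever [rho] and [k] are. *)
Lemma has_slope_prefix_sum a s k n : has_slope a s ->
  n%:R * a - 1 < (prefix_sum (iter k shift s) n)%:R < n%:R * a + 1.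
Proof.
case=> a01 [rho _ hs].
have -> : (prefix_sum (iter k shift s) n)%:R
  = (prefix_sum s (k + n))%:R - (prefix_sum s k)%:R :> R.
  by rewrite prefix_sumD natrD addrC addKr.
rewrite ![(prefix_sum _ _)%:R]pmulrn.
case: hs => ->.
- rewrite !prefix_sum_sturm // natrD !mulrDl !intrD !intrN.
  have /andP[] := floor_itv (k%:R * a + n%:R * a + rho).
  have /andP[] := floor_itv (k%:R * a + rho).
  by rewrite !intrD => *; lra.
- rewrite !prefix_sum_sturm' // natrD !mulrDl !intrD !intrN.
  have /andP[] := ceil_itv (k%:R * a + n%:R * a + rho).
  have /andP[] := ceil_itv (k%:R * a + rho).
  by rewrite !intrD !intrN => *; lra.
Qed.

Lemma has_slope_sturm a : 0 <= a <= 1 -> has_slope a (sturm a a).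
Proof. by move=> a01; split=> //; exists a => //; left. Qed.

Lemma has_slope_sturm'0 a : 0 <= a <= 1 -> has_slope a (sturm' a 0).
Proof. by move=> a01; split=> //; exists 0; [rewrite lexx ler01|right]. Qed.

(** An integer strictly between [n a - 1] and [n a + 1] lies between the floor and the ceiling of
    [n a]. *)
Lemma has_slope_bounds a s k : has_slope a s ->
  (sturm a 0 <= iter k shift s)%O /\ (iter k shift s <= sturm' a 0)%O.
Proof.
move=> hs; have [a01 _] := hs.
split; apply: prefix_sum_le_lex => n; have /andP[h1 h2] := has_slope_prefix_sum k n hs.
- have /andP[_ h] := prefix_sum_sturm0 n a01.
  by apply: natr_le_lt1 h _; lra.
- have /andP[h _] := prefix_sum_sturm'0 n a01.
  by apply: (@natr_le_lt1 _ _ (prefix_sum (iter k shift s) n)%:R) => //; lra.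
Qed.

Lemma sturm0_bcons a : 0 <= a < 1 -> sturm a 0 = bcons false (sturm a a).
Proof.
move=> a01; apply/funext => -[|n] /=; rewrite /sturm.
  by rewrite mul0r !addr0 mul1r floor0 subr0 (@floor_def _ a 0) // addr0.
by rewrite !addr0 -!natr1 !mulrDl !mul1r.
Qed.

Lemma sturm'0_bcons a : 0 < a <= 1 -> sturm' a 0 = bcons true (sturm' a a).
Proof.
move=> a01; apply/funext => -[|n] /=; rewrite /sturm'.
  by rewrite mul0r !addr0 mul1r ceil0 subr0 (@ceil_def _ a 1) // subrr.
by rewrite !addr0 -!natr1 !mulrDl !mul1r.
Qed.

(** With the first letters put back, prefix sums compare because the ceiling of [(n+1) a] is at most
    its floor plus one. *)
Lemma sturm'_le_sturm a : 0 < a < 1 -> (sturm' a a <= sturm a a)%O.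
Proof.
move=> /andP[a0 a1]; have a01 : 0 <= a <= 1 by lra.
apply: prefix_sum_le_lex => n.
have /andP[_] := prefix_sum_sturm'0 n.+1 a01.
have /andP[] := prefix_sum_sturm0 n.+1 a01.
rewrite sturm0_bcons ?sturm'0_bcons; [|lra|lra].
rewrite !prefix_sum_bcons !natrD /= => h1 h2 h3.
by apply: (@natr_le_lt1 _ _ (n.+1%:R * a)); lra.
Qed.

(* A maximal stretch on which [iter k shift s] follows the lower bound ends in
   a block of length [l] with at least [l * a] ones. *)
Lemma prefix_sum_ge a s : 0 < a < 1 ->
  (forall k, bcons false (sturm' a a) <= iter k shift s)%O ->
  forall n, n%:R * a - 1 <= (prefix_sum s n)%:R.
Proof.
move=> /andP[a0 a1] hs n; have a01 : 0 <= a <= 1 by lra.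
have a01' : 0 < a <= 1 by lra.
have lowE m : (0 < m)%N -> (prefix_sum (sturm' a 0) m)%:R
    = (prefix_sum (bcons false (sturm' a a)) m)%:R + 1 :> R.
  by case: m => // m _; rewrite sturm'0_bcons // !prefix_sum_bcons !natrD /= addrC.
elim/ltn_ind: n s hs => -[_ s _|n IH s hs]; first by rewrite mul0r prefix_sum0; lra.
have /andP[h _] := prefix_sum_sturm'0 n.+1 a01; rewrite lowE // in h.
have /= := hs 0%N; rewrite le_eqVlt => /orP[/eqP /= <-|/lex_lt_inv[m [e xm sm]]]; first lra.
case: (ltnP n m) => [lnm|lmn].
  by rewrite -(eq_prefix_sum (x := bcons false (sturm' a a))); [lra|move=> i li; apply: e; lia].
(* The bound starts with 0 instead of 1, hence lags by one; the extra 1 of [s] at index [m] makes up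
   for it, so the block has [ceil ((m+1) a)] ones. *)
have eS : (prefix_sum s m.+1)%:R = (prefix_sum (sturm' a 0) m.+1)%:R :> R.
  by rewrite lowE // !prefix_sumS -(eq_prefix_sum e) xm sm addn0 addn1 natr1.
have -> : n.+1 = (m.+1 + (n - m))%N by lia.
have := IH (n - m)%N _ (iter m.+1 shift s) _.
rewrite prefix_sumD !natrD mulrDl eS.
have /andP[h' _] := prefix_sum_sturm'0 m.+1 a01.
move=> h2; suff : (n - m)%:R * a - 1 <= (prefix_sum (iter m.+1 shift s) (n - m))%:R by lra.
by apply: h2 => [|k]; [lia | rewrite -iterD].
Qed.

(** Each block of length [l], cut where [s] first drops below the bound, has fewer than [l * a]
    ones; only the last, incomplete block costs the summand 1. *)
Lemma prefix_sum_le a s : 0 <= a <= 1 ->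
  (forall k, iter k shift s <= sturm' a 0)%O ->
  forall n, (prefix_sum s n)%:R <= n%:R * a + 1.
Proof.
move=> a01 hs n.
elim/ltn_ind: n s hs => -[_ s _|n IH s hs]; first by rewrite mul0r prefix_sum0; lra.
have /andP[_ h] := prefix_sum_sturm'0 n.+1 a01.
have /= := hs 0%N; rewrite le_eqVlt => /orP[/eqP /= ->|/lex_lt_inv[m [e sm ym]]]; first lra.
case: (ltnP n m) => [lnm|lmn].
  by rewrite (eq_prefix_sum (y := sturm' a 0)); [lra|move=> i li; apply: e; lia].
have eS : (prefix_sum s m.+1)%:R + 1 = (prefix_sum (sturm' a 0) m.+1)%:R :> R.
  by rewrite !prefix_sumS (eq_prefix_sum e) ym sm addn0 addn1 natr1.
have -> : n.+1 = (m.+1 + (n - m))%N by lia.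
have := IH (n - m)%N _ (iter m.+1 shift s) _.
rewrite prefix_sumD !natrD mulrDl.
have /andP[_ h'] := prefix_sum_sturm'0 m.+1 a01.
move=> h2; suff : (prefix_sum (iter m.+1 shift s) (n - m))%:R <= (n - m)%:R * a + 1 by lra.
by apply: h2 => [|k]; [lia | rewrite -iterD].
Qed.

(* If [y] left [sturm' a 0] downwards at index [N], then [s] would split into
   blocks of length at most [N + 1], each missing a fixed amount [d] of the
   expected number of ones. *)
Lemma sturm'0_le_upper_bound a s y : 0 < a < 1 ->
  (forall k, bcons false (sturm' a a) <= iter k shift s)%O ->
  (forall k, iter k shift s <= y)%O -> (sturm' a 0 <= y)%O.
Proof.
move=> a01 hl hu; rewrite leNgt; apply/negP => ylt.
have a01' : 0 <= a <= 1 by lra.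
have [N [e yN zN]] := lex_lt_inv ylt.
pose f n : R := n%:R * a + 1 - (prefix_sum (sturm' a 0) n)%:R.
have f0 n : 0 < f n by have := prefix_sum_sturm'0 n a01'; rewrite /f; lra.
have [d d0 hd] := positive_lower_bound N.+1 f0.
have block k : exists l, (prefix_sum (iter k shift s) l)%:R <= l%:R * a - d.
  have /lex_lt_inv[m [em sm zm]] := le_lt_trans (hu k) ylt.
  (* A later disagreement would make this shift follow [sturm' a 0] through index [N] and so exceed
     [y]. *)
  have mN : (m <= N)%N.
    rewrite leqNgt; apply/negP => lNm.
    have : (y < iter k shift s)%O.
      apply: (@lex_ltI _ _ N) => //; last by rewrite em.
      by move=> i li; rewrite e // em // (ltn_trans li).
    by rewrite ltNge hu.
  exists m.+1; have := hd m.+1 mN; rewrite /f !prefix_sumS (eq_prefix_sum em) sm zm.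
  by rewrite !natrD /=; lra.
have deficit j : exists n, (prefix_sum s n)%:R <= n%:R * a - j%:R * d.
  elim: j => [|j [n hn]]; first by exists 0%N; rewrite prefix_sum0; lra.
  have [l hl'] := block n; exists (n + l)%N.
  by rewrite prefix_sumD !natrD -natr1; lra.
suff : d <= 0 by lra.
(* The accumulated deficit [j * d] cannot exceed the 1 allowed by the lower density bound. *)
apply: (@archimedean_le0 _ 1) => j; have [n hn] := deficit j.
by have := prefix_sum_ge a01 hl n; lra.
Qed.

(** * The interval [[u-(a), u+(a)]] and the value of [phi] *)

Definition in_slope_range a u := [&& 0 < a < 1, (sturm' a a <= u)%O & (u <= sturm a a)%O].

Lemma in_slope_range_lower a u s : in_slope_range a u ->
  (forall k, bcons false u <= iter k shift s)%O ->
  (forall k, bcons false (sturm' a a) <= iter k shift s)%O.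
Proof. by move=> /and3P[_ h _] hs k; apply: le_trans (hs k); rewrite bcons_le. Qed.

Lemma in_slope_range_Sigma a u : in_slope_range a u ->
  Sigma (bcons false u) (sturm' a 0) (sturm' a 0).
Proof.
move=> /and3P[a01 _ h] k; have a01' : 0 <= a <= 1 by lra.
have [h1 h2] := has_slope_bounds k (has_slope_sturm'0 a01').
by split=> //; apply: le_trans h1; rewrite sturm0_bcons ?bcons_le //; lra.
Qed.

Lemma in_slope_range_phi a u : in_slope_range a u -> phi (bcons false u) = sturm' a 0.
Proof.
move=> ha; have [lb glb] := phiP (bcons false u).
have /and3P[a01 _ _] := ha.
apply/eqP; rewrite eq_le; apply/andP; split.
  by apply: lb; exists (sturm' a 0); apply: in_slope_range_Sigma.
apply: glb => y [s hs].
apply: (sturm'0_le_upper_bound a01 (s := s)) => [|k]; last by case: (hs k).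
by apply: in_slope_range_lower ha _ => k; case: (hs k).
Qed.

(** The two bounds force density [a] on [s], while its slope gives density [b]; all errors are
    bounded, so [n * (b - a)] and [n * (a - b)] never exceed 2. *)
Lemma in_slope_range_eq a b u s : in_slope_range a u -> has_slope b s ->
  Sigma (bcons false u) (sturm' a 0) s -> b = a.
Proof.
move=> ha hb hs; have /and3P[a01 _ _] := ha; have a01' : 0 <= a <= 1 by lra.
have h1 n : n%:R * a - 1 <= (prefix_sum s n)%:R.
  by apply: prefix_sum_ge => //; apply: in_slope_range_lower ha _ => k; case: (hs k).
have h2 n : (prefix_sum s n)%:R <= n%:R * a + 1.
  by apply: prefix_sum_le => // k; case: (hs k).
have h3 n := has_slope_prefix_sum 0 n hb.
suff [] : b - a <= 0 /\ a - b <= 0 by lra.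
by split; apply: (@archimedean_le0 _ 2) => n;
  have := h1 n; have := h2 n; have := h3 n => /=; lra.
Qed.

(** Such an [s] is an upper bound of its own shifts, so [sturm'0_le_upper_bound] applies with
    [y := s]. *)
Lemma in_slope_range_max a u s : in_slope_range a u ->
  Sigma (bcons false u) (sturm' a 0) s -> (forall k, iter k shift s <= s)%O ->
  s = sturm' a 0.
Proof.
move=> ha hs hmax; have /and3P[a01 _ _] := ha.
apply/eqP; rewrite eq_le; case: (hs 0%N) => _ /= -> /=.
apply: sturm'0_le_upper_bound hmax => //.
by apply: in_slope_range_lower ha _ => k; case: (hs k).
Qed.

(** Both slopes yield the same [phi (bcons false u)], so [sturm' a 0] meets the constraints attached
    to [b], and its density decides. *)
Lemma in_slope_range_inj a b u : in_slope_range a u -> in_slope_range b u -> a = b.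
Proof.
move=> ha hb; have /and3P[a01 _ _] := ha; have a01' : 0 <= a <= 1 by lra.
apply: (in_slope_range_eq hb (has_slope_sturm'0 a01')).
rewrite -(in_slope_range_phi hb) (in_slope_range_phi ha).
exact: in_slope_range_Sigma.
Qed.

(** * Dependence on the slope, and existence of an interval containing [u] *)

Lemma sturm'0_left_continuous a N : 0 <= a <= 1 ->
  exists2 e, 0 < e & forall b, 0 <= b -> a - e < b <= a ->
    forall i, (i < N)%N -> sturm' b 0 i = sturm' a 0 i.
Proof.
move=> a01; pose f n : R := n%:R * a + 1 - (prefix_sum (sturm' a 0) n)%:R.
have f0 n : 0 < f n by have := prefix_sum_sturm'0 n a01; rewrite /f; lra.
have [d d0 hd] := positive_lower_bound N f0.
(* For [n <= N], [n a] exceeds [ceil (n a) - 1] by at least [d], and [n (a - b)] stays below [d], so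
   no ceiling changes. *)
exists (d / N.+1%:R); first by rewrite divr_gt0 // ltr0n.
move=> b b0 /andP[lb ub]; apply: prefix_sum_inj => n nN.
have b01 : 0 <= b <= 1 by lra.
have /andP[ha1 ha2] := prefix_sum_sturm'0 n a01.
have /andP[hb1 hb2] := prefix_sum_sturm'0 n b01.
have nab : n%:R * b <= n%:R * a by rewrite ler_wpM2l.
have close : n%:R * a - d < n%:R * b.
  have : N.+1%:R * (a - b) < d.
    by rewrite mulrC -ltr_pdivlMr ?ltr0n // ltrBlDr addrC -ltrBlDr.
  have : n%:R * (a - b) <= N.+1%:R * (a - b).
    by rewrite ler_wpM2r ?subr_ge0 // ler_nat ltnW.
  lra.
have := hd n nN; rewrite /f => hf.
apply/eqP; rewrite eqn_leq; apply/andP; split.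
  by rewrite -ltnS -(ltr_nat R) -natr1; lra.
by rewrite -ltnS -(ltr_nat R) -natr1; lra.
Qed.

Lemma sturm0_right_continuous a N : 0 <= a <= 1 ->
  exists2 e, 0 < e & forall b, b <= 1 -> a <= b < a + e ->
    forall i, (i < N)%N -> sturm b 0 i = sturm a 0 i.
Proof.
(* [f n] is the distance from [n a] up to the next larger integer, the room left before the floor
   changes. *)
move=> a01; pose f n : R := (prefix_sum (sturm a 0) n)%:R + 1 - n%:R * a.
have f0 n : 0 < f n by have := prefix_sum_sturm0 n a01; rewrite /f; lra.
have [d d0 hd] := positive_lower_bound N f0.
exists (d / N.+1%:R); first by rewrite divr_gt0 // ltr0n.
move=> b b1 /andP[lb ub]; apply: prefix_sum_inj => n nN.
have b01 : 0 <= b <= 1 by lra.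
have /andP[ha1 ha2] := prefix_sum_sturm0 n a01.
have /andP[hb1 hb2] := prefix_sum_sturm0 n b01.
have nab : n%:R * a <= n%:R * b by rewrite ler_wpM2l.
have close : n%:R * b < n%:R * a + d.
  have : N.+1%:R * (b - a) < d.
    by rewrite mulrC -ltr_pdivlMr ?ltr0n // ltrBlDr addrC.
  have : n%:R * (b - a) <= N.+1%:R * (b - a).
    by rewrite ler_wpM2r ?subr_ge0 // ler_nat ltnW.
  lra.
have := hd n nN; rewrite /f => hf.
apply/eqP; rewrite eqn_leq; apply/andP; split.
  by rewrite -ltnS -(ltr_nat R) -natr1; lra.
by rewrite -ltnS -(ltr_nat R) -natr1; lra.
Qed.

Lemma sturm'1 : sturm' (1 : R) 0 = bconst true.
Proof.
apply/funext => n; rewrite /sturm' !mulr1 !addr0 !pmulrn !intrKceil.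
by rewrite /bconst; lia.
Qed.

Lemma sturm0 : sturm (0 : R) 0 = bconst false.
Proof. by apply/funext => n; rewrite /sturm !mulr0 !addr0 subrr. Qed.

Lemma sturm'0_0 : sturm' (0 : R) 0 = bconst false.
Proof. by apply/funext => n; rewrite /sturm' !mulr0 !addr0 subrr. Qed.

(* The slope is the supremum of all [b] with [sturm' b 0 <= bcons true u]. *)
Lemma in_slope_range_exists u : u <> bconst false -> u <> bconst true ->
  exists a, in_slope_range a u.
Proof.
move=> u0 u1.
pose A : set R := [set b | 0 <= b <= 1 /\ (sturm' b 0 <= bcons true u)%O]%classic.
have A0 : A 0 by split; [rewrite lexx ler01|rewrite sturm'0_0 lex_bot].
have supA : has_sup A by split; [exists 0|exists 1 => b [/andP[]]].
pose a := sup A.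
have a0 : 0 <= a by apply: sup_upper_bound.
have a1 : a <= 1 by apply: ge_sup => [|b [/andP[]]] //; exists 0.
have a01 : 0 <= a <= 1 by rewrite a0.
have low : (sturm' a 0 <= bcons true u)%O.
  rewrite leNgt; apply/negP => /lex_lt_inv[N [e uN sN]].
  (* Left-continuity passes the disagreement on to some [b] in [A] close to [a], contradicting
     membership in [A]. *)
  have [d d0 hd] := sturm'0_left_continuous N.+1 a01.
  have [b [/andP[b0 b1] Ab] lb] := sup_adherent d0 supA.
  have ub : b <= a by apply: sup_upper_bound => //; split => //; rewrite b0.
  have eb := hd b b0 (introT andP (conj lb ub)).
  suff : (bcons true u < sturm' b 0)%O by rewrite ltNge Ab.
  by apply: (@lex_ltI _ _ N) => [i li||]; rewrite ?eb //; [apply: e|lia].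
have lt1 : a < 1.
  rewrite lt_neqAle a1 andbT; apply/eqP => a1E.
  apply: u1; apply/eqP; rewrite eq_le lex_top /=.
  move: low; rewrite a1E sturm'1.
  by rewrite -{1}(bcons_const true) bcons_le.
have up : (bcons false u <= sturm a 0)%O.
  rewrite leNgt; apply/negP => /lex_lt_inv[N [e sN uN]].
  have [d d0 hd] := sturm0_right_continuous N.+1 a01.
  (* Halving both margins keeps [b] above [a], within [d] of it and below 1. Then [sturm b b < u]
     puts [b] into [A], beyond its supremum. *)
  pose b := a + Num.min (d / 2) ((1 - a) / 2).
  have [lb ub b1] : [/\ a < b, b < a + d & b < 1].
    rewrite /b.
    have h1 : Num.min (d / 2) ((1 - a) / 2) <= d / 2 by rewrite ge_min lexx.
    have h2 : Num.min (d / 2) ((1 - a) / 2) <= (1 - a) / 2 by rewrite ge_min lexx orbT.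
    have h3 : 0 < Num.min (d / 2) ((1 - a) / 2) by rewrite lt_min; apply/andP; split; lra.
    by split; lra.
  have eb := hd b (ltW b1) (introT andP (conj (ltW lb) ub)).
  have : (sturm b 0 < bcons false u)%O.
    by apply: (@lex_ltI _ _ N) => [i li||]; rewrite ?eb //; [apply: e|lia].
  rewrite sturm0_bcons; last lra.
  rewrite bcons_lt => bu.
  suff : b <= a by lra.
  apply: sup_upper_bound => //; split; first lra.
  rewrite sturm'0_bcons ?bcons_le; last lra.
  by apply: le_trans (ltW bu); apply: sturm'_le_sturm; lra.
have gt0 : 0 < a.
  rewrite lt_neqAle a0 andbT eq_sym; apply/eqP => a0E; apply: u0; apply/eqP.
  rewrite eq_le lex_bot andbT; move: up; rewrite a0E sturm0.
  by rewrite -{1}(bcons_const false) bcons_le.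
exists a; rewrite /in_slope_range gt0 lt1 /=.
move: low up; rewrite sturm'0_bcons ?sturm0_bcons ?bcons_le; [|lra|lra].
by move=> -> ->.
Qed.

(** * Irrational slopes, and fractions in lowest terms *)

Lemma irrational_not_int a n : irrational a -> n.+1%:R * a \isn't a Num.int.
Proof.
move=> irr; apply/negP => /intrP[m hm]; apply: irr.
exists (m%:~R / n.+1%:R) => //.
rewrite fmorph_div /= ratr_int ratr_nat -hm mulrC mulKf //.
by rewrite pnatr_eq0.
Qed.

(** At non-integers the ceiling is the floor plus one, and these ones cancel in the differences. The
    offset [a] keeps the multiples of [a] away from the integer [0 * a]. *)
Lemma irrational_sturm' a : 0 < a < 1 -> irrational a -> sturm' a a = sturm a a.
Proof.
move=> a01 irr; apply/funext => n; rewrite /sturm' /sturm.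
have e m : m%:R * a + a = m.+1%:R * a by rewrite -natr1 mulrDl mul1r.
by rewrite !e !ceil_floor !irrational_not_int // opprD addrACA subrr addr0.
Qed.

Lemma rational_natr_div (p q : nat) : rational (p%:R / q%:R : R).
Proof. by exists (p%:R / q%:R) => //; rewrite fmorph_div /= !ratr_nat. Qed.

Lemma rational_slope_pair a : 0 < a < 1 -> rational a ->
  exists p q, slope_pair p q /\ a = p%:R / q%:R.
Proof.
move=> a01 [x _ xa]; exists `|numq x|%N, `|denq x|%N.
have x01 : 0 < x < 1 by have := ltr_rat R 0 x; have := ltr_rat R x 1; rewrite rmorph0 rmorph1 xa => <- <-.
have d0 := denq_gt0 x.
have n0 : 0 < numq x by rewrite numq_gt0; case/andP: x01.
have e : a = `|numq x|%N%:R / `|denq x|%N%:R.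
  by rewrite -xa /ratr -{1}(gtz0_abs n0) -{1}(gtz0_abs d0).
split=> //; split; [lia| |exact: coprime_num_den].
move: a01; rewrite e => /andP[_].
by rewrite ltr_pdivrMr ?mul1r ?ltr_nat // ltr0n; lia.
Qed.

Lemma slope_pair_inj (p q p' q' : nat) : slope_pair p q -> slope_pair p' q' ->
  p%:R / q%:R = p'%:R / q'%:R :> R -> (p, q) = (p', q').
Proof.
move=> [p0 pq cpq] [p0' pq' cpq'] /eqP.
rewrite eqr_div ?pnatr_eq0; [|lia|lia].
rewrite -!natrM eqr_nat => /eqP e.
have ep : p = p'.
  apply/eqP; rewrite eqn_dvd -(Gauss_dvdl p' cpq) -e dvdn_mulr //=.
  by rewrite -(Gauss_dvdl p cpq') e dvdn_mulr.
by move: e; rewrite -ep => /eqP; rewrite eqn_pmul2l // => /eqP ->.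
Qed.

(** This rotation turns [0w1] into [w10] and [1w0] into [w01]. *)
Lemma shift_per (d : bool) w : shift (per (d :: w)) = per (rcons w d).
Proof.
apply/funext => n; rewrite /shift /per size_rcons /=.
have := ltn_pmod n (ltn0Sn (size w)).
rewrite -[in nth _ _ _](addn1 n) -modnDml leq_eqVlt => /orP[/eqP [e]|].
  by rewrite e addn1 modnn nth_rcons ltnn eqxx.
by rewrite ltnS => h; rewrite addn1 modn_small //= nth_rcons h.
Qed.

(** * Rational slopes: central words and periodicity *)

Section RationalSlope.
Variables p q : nat.
Hypothesis hpq : slope_pair p q.
Local Notation a := (p%:R / q%:R : R).

Lemma slope_pair_itv : 0 < a < 1.
Proof.
have [p0 pq _] := hpq.
have q0 : (0 : R) < q%:R by rewrite ltr0n; lia.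
by rewrite ltr_pdivrMr // mul1r ltr_nat pq divr_gt0 // ltr0n.
Qed.

Lemma sturm_central : sturm a a = per (central R p q ++ [:: true; false]).
Proof.
have a01 := slope_pair_itv.
rewrite -(shift_bcons false (sturm a a)) -sturm0_bcons; last lra.
by rewrite central_lower // shift_per -cats1 -catA.
Qed.

Lemma sturm'_central : sturm' a a = per (central R p q ++ [:: false; true]).
Proof.
have a01 := slope_pair_itv.
rewrite -(shift_bcons true (sturm' a a)) -sturm'0_bcons; last lra.
by rewrite central_upper // shift_per -cats1 -catA.
Qed.

(** Advancing the index by [q] adds the integer [p] to the argument of every floor or ceiling. *)
Lemma has_slope_periodic s : has_slope a s -> iter q shift s = s.
Proof.
move=> [a01 [rho _ hs]]; apply/funext => n; rewrite iter_shiftE.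
have q0 : q%:R != 0 :> R by have [? ? _] := hpq; rewrite pnatr_eq0; lia.
have e m : (q + m)%:R * a + rho = (m%:R * a + rho) + p%:R.
  by rewrite natrD mulrDl mulrC divfK //; ring.
have pZ : (p%:R : R) \is a Num.int by apply: natr_int.
case: hs => ->; rewrite /sturm /sturm' -addnS !e.
  by rewrite !(floorDrz _ pZ) opprD addrACA subrr addr0.
by rewrite !(ceilDrz _ pZ) opprD addrACA subrr addr0.
Qed.

(** Periodicity leaves finitely many shifts, so some shift [i] is maximal and equals [sturm' a 0];
    another [q - i] shifts complete the period and return to [s]. *)
Lemma in_slope_range_shift u s : in_slope_range a u -> has_slope a s ->
  Sigma (bcons false u) (sturm' a 0) s -> exists j, s = iter j shift (sturm' a 0).
Proof.
move=> ha hsl hs; have q0 : (0 < q)%N by have [? ? _] := hpq; lia.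
have per_s := has_slope_periodic hsl.
have iter_mod k : iter k shift s = iter (k %% q) shift s.
  rewrite {1}(divn_eq k q) addnC iterD; congr iter.
  by elim: (k %/ q)%N => // m IH; rewrite mulSn iterD IH.
have [i _ hi] := arg_maxP (fun i : 'I_q => iter i shift s) (erefl (xpredT (Ordinal q0))).
have max_i k : (iter k shift s <= iter i shift s)%O.
  by rewrite iter_mod; apply: (hi (Ordinal (ltn_pmod k q0))).
have <- : iter i shift s = sturm' a 0.
  by apply: (in_slope_range_max ha) => k; rewrite -iterD.
by exists (q - i)%N; rewrite -iterD subnK // ltnW.
Qed.

End RationalSlope.

Lemma char_periodic_range (p q : nat) u : char_periodic R p q u ->
  in_slope_range (p%:R / q%:R) u.
Proof.
move=> [hpq]; rewrite -sturm_central // -sturm'_central //.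
have a01 := slope_pair_itv hpq; have le := sturm'_le_sturm a01.
by case=> ->; rewrite /in_slope_range a01 le lexx.
Qed.

Lemma in_gap_range (p q : nat) u : in_gap R p q u -> in_slope_range (p%:R / q%:R) u.
Proof.
move=> [hpq]; rewrite -sturm_central // -sturm'_central // => -[h1 h2].
by rewrite /in_slope_range slope_pair_itv //= !ltW.
Qed.

(** An irrational slope would shrink the interval to a characteristic Sturmian point; for a rational
    slope the ends are characteristic periodic, so [u] is strictly inside. *)
Lemma generic_in_gap u : generic R u -> exists p q, in_gap R p q u.
Proof.
move=> [u0 u1 nst nper]; have [a ha] := in_slope_range_exists u0 u1.
have /and3P[a01 h1 h2] := ha.
have rat : rational a.
  apply: contrapT => irr; apply: nst; exists a => //.
  by apply/eqP; rewrite eq_le h2 -irrational_sturm'.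
have [p [q [hpq e]]] := rational_slope_pair a01 rat.
exists p, q; split=> //.
rewrite -sturm_central // -sturm'_central // -e.
rewrite !lt_neqAle h1 h2 !andbT; split; apply/eqP => eu; apply: nper; exists p, q;
  split=> //; [right|left]; by rewrite -?sturm_central -?sturm'_central // -e.
Qed.

Lemma char_sturmian_range u : char_sturmian R u ->
  exists a, [/\ irrational a, u = sturm a a, sturm' a 0 = bcons true u & in_slope_range a u].
Proof.
move=> [a [a01 irr] ->]; exists a; rewrite /in_slope_range a01.
rewrite sturm'0_bcons ?irrational_sturm' ?lexx //; lra.
Qed.

End Mechanical.

(** * Bounds starting with 1, and constant [u] *)

Lemma phi_bcons_true u : phi (bcons true u) = bconst true.
Proof.
have [_ glb] := phiP (bcons true u).
apply/eqP; rewrite eq_le lex_top /=; apply: glb => y [s hs].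
suff <- : s = bconst true by case: (hs 0%N).
apply/funext => n; apply/negPn/negP => sn; have [+ _] := hs n.
rewrite leNgt => /negP; apply; apply: (@lex_ltI _ _ 0%N) => //.
by rewrite iter_shiftE addn0; apply/negbTE.
Qed.

Lemma phi_bcons_const (b : bool) : phi (bcons false (bconst b)) = bconst b.
Proof.
have [lb glb] := phiP (bcons false (bconst b)).
apply/eqP; rewrite eq_le; case: b lb glb => lb glb; rewrite ?lex_top ?lex_bot ?andbT /=.
- apply: glb => y [s hs].
  have tail1 n : ~~ s n -> iter n.+1 shift s = bconst true.
    move=> /negbTE sn; apply/eqP; rewrite eq_le lex_top /=.
    have [+ _] := hs n; rewrite -(bcons_shift (iter n shift s)) iter_shiftE addn0 sn.
    by rewrite bcons_le.
  (* Either the tail after some 0 is [1^oo], or [s] itself is; in both cases [y] is at least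
     [1^oo]. *)
  have [[n sn]|ns] := pselect (exists n, ~~ s n).
    by rewrite -(tail1 n sn); case: (hs n.+1).
  suff <- : s = bconst true by case: (hs 0%N).
  by apply/funext => n; apply/negPn/negP => sn; apply: ns; exists n.
- apply: lb; exists (bconst false) => k.
  have -> : iter k shift (bconst false) = bconst false.
    by apply/funext => n; rewrite iter_shiftE.
  by rewrite bcons_const lexx.
Qed.

(** The bounds alone admit every sequence of the right slope. Uniqueness is therefore up to slope in
    (iii) and up to a shift in (iv) and (v), and becomes equality for [s] dominating its own
    shifts. *)
Theorem theorem2p5 (R : realType) (u : binseq) :
  (* (i) *)
  phi (bcons true u) = bconst true
  /\
  (* (ii) *)
  (u = bconst false \/ u = bconst true -> phi (bcons false u) = u)
  /\
  (* (iii) *)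
  (char_sturmian R u ->
     [/\ phi (bcons false u) = bcons true u,
         sturmian R (bcons true u),
         (forall k, (bcons false u <= iter k shift (bcons true u))%O /\
                    (iter k shift (bcons true u) <= bcons true u)%O) &
         forall s : binseq, sturmian R s ->
           (forall k, (bcons false u <= iter k shift s)%O /\
                      (iter k shift s <= bcons true u)%O) ->
           (exists2 a : R, has_slope a u & has_slope a s) /\
           ((forall k, (iter k shift s <= s)%O) -> s = bcons true u)])
  /\
  (* (iv) *)
  (forall p q : nat, char_periodic R p q u ->
     phi (bcons false u) = sturm' (p%:R / q%:R : R) 0 /\
     sturm' (p%:R / q%:R : R) 0 = per (true :: central R p q ++ [:: false]))
  /\
  (* (v) *)
  (generic R u ->
     (exists! pq : nat * nat, in_gap R pq.1 pq.2 u) /\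
     (forall p q : nat, in_gap R p q u ->
        phi (bcons false u) = sturm' (p%:R / q%:R : R) 0 /\
        sturm' (p%:R / q%:R : R) 0 = per (true :: central R p q ++ [:: false])))
  /\
  (* the final claim on cases (iv) and (v) *)
  ((exists p q : nat, char_periodic R p q u) \/ generic R u ->
     [/\ periodic_balanced R (phi (bcons false u)),
         (forall k, (bcons false u <= iter k shift (phi (bcons false u)))%O /\
                    (iter k shift (phi (bcons false u)) <= phi (bcons false u))%O) &
         forall s : binseq, periodic_balanced R s ->
           (forall k, (bcons false u <= iter k shift s)%O /\
                      (iter k shift s <= phi (bcons false u))%O) ->
           (exists j, s = iter j shift (phi (bcons false u))) /\
           ((forall k, (iter k shift s <= s)%O) -> s = phi (bcons false u))]).
Proof.
split; first exact: phi_bcons_true.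
split; first by case=> ->; apply: phi_bcons_const.
split.
  move=> /char_sturmian_range[a [irr uE e1 ha]].
  have /and3P[a01 _ _] := ha; have a01' : 0 <= a <= 1 by lra.
  rewrite -e1; split; first exact: in_slope_range_phi.
  - by exists a => //; apply: has_slope_sturm'0.
  - exact: in_slope_range_Sigma ha.
  - move=> s [b _ hb] hs; split; last exact: in_slope_range_max ha hs.
    have ? := in_slope_range_eq ha hb hs; subst b.
    by exists a => //; rewrite uE; apply: has_slope_sturm.
split.
  move=> p q hu; split; first by apply/in_slope_range_phi/char_periodic_range.
  by case: hu => hpq _; apply: central_upper.
split.
  move=> hu; split=> [|p q hpq]; last first.
    by split; [apply/in_slope_range_phi/in_gap_range|case: hpq => hpq _; apply: central_upper].
  have [p [q hpq]] := generic_in_gap hu; exists (p, q); split=> //= -[p' q'] /= hpq'.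
  have [hp _] := hpq; have [hp' _] := hpq'.
  apply: (slope_pair_inj hp hp').
  by apply: in_slope_range_inj; apply: in_gap_range; eassumption.
(* Cases (iv) and (v) merge here: each places [u] in the interval of a rational slope. *)
move=> hu; have [p [q [hpq ha]]] :
    exists p q, slope_pair p q /\ in_slope_range (p%:R / q%:R : R) u.
  case: hu => [[p [q h]]|/generic_in_gap[p [q h]]]; exists p, q.
    by split; [case: h|apply: char_periodic_range].
  by split; [case: h|apply: in_gap_range].
rewrite (in_slope_range_phi ha).
have /and3P[a01 _ _] := ha; have a01' : 0 <= (p%:R / q%:R : R) <= 1 by lra.
split; first by exists (p%:R / q%:R); [apply: rational_natr_div|apply: has_slope_sturm'0].
  exact: in_slope_range_Sigma ha.
move=> s [b _ hb] hs; split; last exact: in_slope_range_max ha hs.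
have ? := in_slope_range_eq ha hb hs; subst b.
exact: in_slope_range_shift hb hs.
Qed.
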